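(* Let $\zeta,\eta\ge1$ and $m,n\ge0$ be integers, and let $t\ge3$ be an odd integer. Then $\overline{S}_t^{\,2^\zeta m+\eta}(n)\equiv\overline{S}_t^{\,\eta}(n)\pmod{2^{\zeta+1}}$.
   Context: For $|q|<1$ and a positive integer $k$, write $f_k=\prod_{j\ge1}(1-q^{kj})$. For an odd integer $t\ge3$ and a positive integer $r$, the number $\overline{S}_t^{\,r}(n)$ of $t$-Schur overpartitions of $n$ with $r$-tuples is defined by $\sum_{n\ge0}\overline{S}_t^{\,r}(n)q^n=\prod_{n\ge1}\frac{(1+q^{2n-1})^r(1-q^{t(2n-1)})^r}{(1+q^{t(2n-1)})^r(1-q^{2n-1})^r}=\frac{f_2^{3r}f_t^{2r}f_{4t}^r}{f_1^{2r}f_4^rf_{2t}^{3r}}$. *)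

(* Defs.v *)
From HB Require Import structures.
From mathcomp Require Import all_boot all_order all_algebra.
From mathcomp Require Import boolp classical_sets.

Set Implicit Arguments.
Unset Strict Implicit.
Unset Printing Implicit Defensive.

Import GRing.Theory.
Local Open Scope ring_scope.

(* Formal power series in one variable q over R; (f n) is the coefficient of
   q^n. *)
Record fps (R : Type) := Fps { coefs :> nat -> R }.

Lemma fpsP (R : Type) (f g : fps R) : (forall n, f n = g n) <-> f = g.
Proof.
split=> [|-> //]; case: f g => [f] [g] /= fg.
by congr Fps; apply: functional_extensionality_dep.
Qed.

HB.instance Definition _ (R : Type) := gen_eqMixin (fps R).
HB.instance Definition _ (R : Type) := gen_choiceMixin (fps R).

Section FpsZmodule.
Variable R : zmodType.
Implicit Types f g h : fps R.

Definition fps_zero : fps R := Fps (fun=> 0).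
Definition fps_opp f : fps R := Fps (fun n => - f n).
Definition fps_add f g : fps R := Fps (fun n => f n + g n).

Lemma fps_addA : associative fps_add.
Proof. by move=> f g h; apply/fpsP => n /=; rewrite addrA. Qed.
Lemma fps_addC : commutative fps_add.
Proof. by move=> f g; apply/fpsP => n /=; rewrite addrC. Qed.
Lemma fps_add0 : left_id fps_zero fps_add.
Proof. by move=> f; apply/fpsP => n /=; rewrite add0r. Qed.
Lemma fps_addN : left_inverse fps_zero fps_opp fps_add.
Proof. by move=> f; apply/fpsP => n /=; rewrite addNr. Qed.

HB.instance Definition _ :=
  GRing.isZmodule.Build (fps R) fps_addA fps_addC fps_add0 fps_addN.

Lemma fps0E n : (0 : fps R) n = 0. Proof. by []. Qed.
Lemma fpsDE f g n : (f + g) n = f n + g n. Proof. by []. Qed.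
Lemma fpsNE f n : (- f) n = - f n. Proof. by []. Qed.
End FpsZmodule.

Section FpsRing.
Variable R : comNzRingType.
Implicit Types f g h : fps R.

Definition fps_one : fps R := Fps (fun n => (n == 0)%:R).
Definition fps_mul f g : fps R :=
  Fps (fun n => \sum_(i < n.+1) f i * g (n - i)%N).

(* The polynomial of the terms of f of degree < N. *)
Definition fps_trunc (N : nat) f : {poly R} := \poly_(i < N) f i.

Lemma fps_mul_trunc f g N n : (n < N)%N ->
  fps_mul f g n = (fps_trunc N f * fps_trunc N g)`_n.
Proof.
move=> ltnN; rewrite coefM; apply: eq_bigr => i _; rewrite !coef_poly.
by rewrite (leq_ltn_trans (leq_subr _ _) ltnN) (leq_ltn_trans (leq_ord i) ltnN).
Qed.

Lemma fps_mulC : commutative fps_mul.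
Proof.
by move=> f g; apply/fpsP => n; rewrite !(@fps_mul_trunc _ _ n.+1) // mulrC.
Qed.

Lemma fps_mulA : associative fps_mul.
Proof.
move=> f g h; apply/fpsP => n.
have trM (u v : fps R) (i : nat) : (i < n.+1)%N ->
    (fps_trunc n.+1 (fps_mul u v))`_i
    = (fps_trunc n.+1 u * fps_trunc n.+1 v)`_i.
  by move=> lti; rewrite coef_poly lti (fps_mul_trunc _ _ lti).
rewrite !(@fps_mul_trunc _ _ n.+1) //.
transitivity (fps_trunc n.+1 f * fps_trunc n.+1 g * fps_trunc n.+1 h)`_n.
  rewrite -mulrA !coefM; apply: eq_bigr => i _.
  by rewrite trM // ltnS leq_subr.
by rewrite !coefM; apply: eq_bigr => i _; rewrite trM.
Qed.

Lemma fps_mul1 : left_id fps_one fps_mul.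
Proof.
move=> f; apply/fpsP => n /=.
rewrite big_ord_recl /= mul1r subn0 big1 ?addr0 // => i _.
by rewrite mul0r.
Qed.

Lemma fps_mulDl : left_distributive fps_mul +%R.
Proof.
move=> f g h; apply/fpsP => n /=.
by rewrite -big_split /=; apply: eq_bigr => i _; rewrite mulrDl.
Qed.

Lemma fps_oner_neq0 : fps_one != 0.
Proof.
apply/eqP => /fpsP/(_ 0%N) /= /eqP.
by rewrite oner_eq0.
Qed.

HB.instance Definition _ := GRing.Zmodule_isComNzRing.Build (fps R)
  fps_mulA fps_mulC fps_mul1 fps_mulDl fps_oner_neq0.

Lemma fps1E n : (1 : fps R) n = (n == 0)%:R. Proof. by []. Qed.
Lemma fpsME f g n : (f * g) n = \sum_(i < n.+1) f i * g (n - i)%N.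
Proof. by []. Qed.

(* The series q^k. *)
Definition fps_Xn (k : nat) : fps R := Fps (fun n => (n == k)%:R).

Lemma fps_XnD j k : fps_Xn (j + k) = fps_Xn j * fps_Xn k.
Proof.
apply/fpsP => n; rewrite fpsME /=; case: (leqP j n) => [lejn|ltnj].
  rewrite (bigD1 (Ordinal (lejn : (j < n.+1)%N))) //= eqxx mul1r big1.
    by rewrite addr0 -(eqn_add2l j (n - j)) subnKC.
  by move=> i /negPf; rewrite -val_eqE /= => ->; rewrite mul0r.
rewrite big1 => [|i _]; first by rewrite ltn_eqF // ltn_addr.
by rewrite ltn_eqF ?mul0r // (leq_ltn_trans (leq_ord i)).
Qed.
End FpsRing.

Section FpsUnitRing.
Variable R : comUnitRingType.
Implicit Types f g : fps R.

Definition fps_unit : pred (fps R) := fun f => f 0%N \is a GRing.unit.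

(* The coefficients g_0, ..., g_n of the inverse g of f, from
   g_0 = f_0^-1 and g_n = - f_0^-1 (\sum_(i < n) g_i f_(n-i)). *)
Fixpoint fps_inv_seq f (n : nat) : seq R :=
  if n is n'.+1 then
    let s := fps_inv_seq f n' in
    rcons s (- ((f 0%N)^-1 * \sum_(i < n) s`_i * f (n - i)%N))
  else [:: (f 0%N)^-1].

Definition fps_inv f : fps R :=
  if fps_unit f then Fps (fun n => (fps_inv_seq f n)`_n) else f.

Lemma size_fps_inv_seq f n : size (fps_inv_seq f n) = n.+1.
Proof. by elim: n => //= n IHn; rewrite size_rcons IHn. Qed.

Lemma nth_fps_inv_seq f n i : (i <= n)%N ->
  (fps_inv_seq f n)`_i = (fps_inv_seq f i)`_i.
Proof.
elim: n => [|n IHn]; first by rewrite leqn0 => /eqP->.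
rewrite leq_eqVlt => /predU1P[-> //|lein].
by rewrite [in LHS]/= nth_rcons size_fps_inv_seq lein IHn.
Qed.

Lemma fps_mulV : {in fps_unit, left_inverse 1 fps_inv *%R}.
Proof.
move=> f uf; have uf0 : f 0%N \is a GRing.unit by [].
apply/fpsP => n; rewrite fpsME big_ord_recr /= subnn /fps_inv.
have -> : fps_unit f by [].
case: n => [|n] /=; first by rewrite big_ord0 add0r mulVr.
rewrite nth_rcons size_fps_inv_seq ltnn eqxx mulNr mulrC mulrA divrr // mul1r.
apply/eqP; rewrite subr_eq0; apply/eqP; apply: eq_bigr => i _ /=.
by rewrite (@nth_fps_inv_seq f n i) // -ltnS.
Qed.

Lemma fps_unitPl f g : g * f = 1 -> fps_unit f.
Proof.
move=> /fpsP/(_ 0%N); rewrite fpsME big_ord_recr big_ord0 /= add0r subnn => gf1.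
by apply/unitrP; exists (g 0%N); rewrite gf1 mulrC gf1.
Qed.

Lemma fps_inv_out : {in [predC fps_unit], fps_inv =1 id}.
Proof. by move=> f /negPf nuf; rewrite /fps_inv (nuf : fps_unit f = false). Qed.

HB.instance Definition _ := GRing.ComNzRing_hasMulInverse.Build (fps R)
  fps_mulV fps_unitPl fps_inv_out.

Lemma fps_unitE f : (f \is a GRing.unit) = (f 0%N \is a GRing.unit).
Proof. by []. Qed.
End FpsUnitRing.

(* Formal infinite product \prod_(n >= 1) F n : its n-th coefficient is the
   eventual value of the n-th coefficient of the finite products, 0 by
   convention if there is none. *)
Definition fps_infprod (R : comNzRingType) (F : nat -> fps R) : fps R :=
  Fps (fun n => xget 0 [set c : R | exists N0 : nat, forall N : nat,
    (N0 <= N)%N -> (\prod_(1 <= j < N.+1) F j) n = c]).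

(* The n-th factor of the product, for n >= 1. The denominator has constant
   term 1, so it is a unit of fps int. *)
Definition tschur_factor (t r n : nat) : fps int :=
  let q := @fps_Xn int in
  ((1 + q (2 * n - 1)%N) ^+ r * (1 - q (t * (2 * n - 1))%N) ^+ r)
  / ((1 + q (t * (2 * n - 1))%N) ^+ r * (1 - q (2 * n - 1)%N) ^+ r).

(* The number of t-Schur overpartitions of n with r-tuples. *)
Definition tschur_overpartitions (t r n : nat) : int :=
  fps_infprod (tschur_factor t r) n.

Lemma fps_infprodE (R : comNzRingType) (F : nat -> fps R) :
  (forall j i : nat, (0 < j)%N -> (i < j)%N -> F j i = (1 : fps R) i) ->
  forall n N : nat, (n <= N)%N ->
  fps_infprod F n = (\prod_(1 <= j < N.+1) F j) n.
Proof.
move=> F1 n N lenN.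
have stab M : (n <= M)%N ->
    (\prod_(1 <= j < M.+1) F j) n = (\prod_(1 <= j < n.+1) F j) n.
  elim: M => [|M IHM]; first by rewrite leqn0 => /eqP->.
  rewrite leq_eqVlt => /predU1P[-> //|lenM]; rewrite -IHM //.
  rewrite big_nat_recr //=; set P := \prod_(_ <= _ < _) _.
  rewrite -[P in RHS]mulr1 !fpsME.
  apply: eq_bigr => i _; rewrite F1 //.
  by rewrite (leq_ltn_trans (leq_subr _ _) lenM).
rewrite stab //= ; apply: xget_unique => /=.
  by exists n => M /stab.
move=> c [M HM]; rewrite -(HM (maxn M n)) ?leq_maxl //.
by rewrite stab ?leq_maxr.
Qed.

Section OneMod.
Variables (R : comUnitRingType) (k : nat).

(* f = 1 up to terms of degree >= k *)
Definition fps_one_mod (f : fps R) := forall i, (i < k)%N -> f i = (1 : fps R) i.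

Lemma fps_one_modM f g :
  fps_one_mod f -> fps_one_mod g -> fps_one_mod (f * g).
Proof.
move=> f1 g1 i ltik; rewrite -[in RHS](mulr1 1) !fpsME.
apply: eq_bigr => j _; rewrite f1 ?g1 //.
- by rewrite (leq_ltn_trans (leq_subr _ _) ltik).
- by rewrite (leq_ltn_trans (leq_ord j) ltik).
Qed.

Lemma fps_one_modX f r : fps_one_mod f -> fps_one_mod (f ^+ r).
Proof.
by move=> f1; elim: r => [|r IHr] //; rewrite exprS; apply: fps_one_modM.
Qed.

Lemma fps_one_modV f :
  f \is a GRing.unit -> fps_one_mod f -> fps_one_mod f^-1.
Proof.
move=> uf f1 i ltik; rewrite -(mulVr uf) -[f^-1 in LHS]mulr1 !fpsME.
by apply: eq_bigr => j _; rewrite f1 // (leq_ltn_trans (leq_subr _ _) ltik).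
Qed.

Lemma fps_one_modDX m : (k <= m)%N -> fps_one_mod (1 + fps_Xn R m).
Proof.
move=> lekm i ltik; rewrite fpsDE /= [i == m]ltn_eqF ?addr0 //.
exact: leq_trans lekm.
Qed.

Lemma fps_one_modBX m : (k <= m)%N -> fps_one_mod (1 - fps_Xn R m).
Proof.
move=> lekm i ltik; rewrite fpsDE fpsNE /= [i == m]ltn_eqF ?subr0 //.
exact: leq_trans lekm.
Qed.
End OneMod.

Lemma tschur_den_unit (t r n : nat) : (0 < t)%N -> (0 < n)%N ->
  (1 + fps_Xn int (t * (2 * n - 1))) ^+ r * (1 - fps_Xn int (2 * n - 1)) ^+ r
    \is a GRing.unit.
Proof.
move=> t0 n0; have m0 : (0 < 2 * n - 1)%N.
  by rewrite subn_gt0 (leq_trans _ (leq_pmulr 2 n0)).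
have tm0 : (0 < t * (2 * n - 1))%N by rewrite muln_gt0 t0.
have key f : fps_one_mod 1 f -> f \is a @GRing.unit (fps int).
  by move=> f1; rewrite fps_unitE f1.
by apply: key; apply: fps_one_modM; apply: fps_one_modX;
  [exact: fps_one_modDX|exact: fps_one_modBX].
Qed.

Lemma tschur_overpartitionsE (t r n N : nat) : (0 < t)%N -> (n <= N)%N ->
  tschur_overpartitions t r n
  = (\prod_(1 <= j < N.+1) tschur_factor t r j) n.
Proof.
move=> t0; apply: fps_infprodE => j i j0.
have lejm : (j <= 2 * j - 1)%N.
  by rewrite mul2n -addnn -addnBA // leq_addr.
have lejtm : (j <= t * (2 * j - 1))%N by rewrite (leq_trans lejm) ?leq_pmull.
move: i; rewrite -/(fps_one_mod j (tschur_factor t r j)) /tschur_factor.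
have DX m : (j <= m)%N -> fps_one_mod j ((1 + fps_Xn int m) ^+ r).
  by move=> lejk; apply/fps_one_modX/fps_one_modDX.
have BX m : (j <= m)%N -> fps_one_mod j ((1 - fps_Xn int m) ^+ r).
  by move=> lejk; apply/fps_one_modX/fps_one_modBX.
apply: fps_one_modM; first by apply: fps_one_modM; [exact: DX|exact: BX].
apply: fps_one_modV; first exact: tschur_den_unit.
by apply: fps_one_modM; [exact: DX|exact: BX].
Qed.

(* Main.v *)
(* With a = q^(2j-1) and b = q^(t(2j-1)), the j-th factor for r = 1 is
   (1 + a)(1 - b) / ((1 + b)(1 - a)), whose numerator and denominator differ by
   2(a - b). Every factor, hence the whole product U, is thus 1 modulo 2, so
   U^(2^zeta) is 1 modulo 2^(zeta+1); the generating series for r is U^r. *)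
Require Import Defs.
From mathcomp Require Import all_boot all_order all_algebra.
From mathcomp Require Import ring.

Import GRing.Theory.
Local Open Scope ring_scope.

Lemma expr_one_mod_pow2 (R : comNzRingType) (x h : R) (z : nat) :
  x = 1 + 2%:R * h -> exists g, x ^+ (2 ^ z) = 1 + (2 ^ z.+1)%:R * g.
Proof.
move=> xE; elim: z => [|z [g IH]]; first by exists h.
(* From (1 + 2^(z+1) g)^2 = 1 + 2^(z+2) g + 2^(2z+2) g^2. *)
exists (g + (2 ^ z)%:R * g ^+ 2).
rewrite expnSr exprM IH !expnS !natrM; ring.
Qed.

(** Serves with c = 2 for the product of the factors, then with c = 2^(zeta+1) for the m-th power of
    U^(2^zeta). *)
Lemma prod_one_mod (R : comNzRingType) (c : R) (I : eqType) (s : seq I)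
    (F : I -> R) :
  (forall i, i \in s -> exists h, F i = 1 + c * h) ->
  exists h, \prod_(i <- s) F i = 1 + c * h.
Proof.
move=> F1; rewrite big_seq.
elim/big_rec: _ => [|i x /F1[h ->] [g ->]]; first by exists 0; ring.
by exists (h + g + c * h * g); ring.
Qed.

Lemma fpsMnE (R : comNzRingType) (f : fps R) (k n : nat) :
  (f *+ k) n = f n *+ k.
Proof. by elim: k => [|k IHk]; rewrite ?mulr0n // !mulrS fpsDE IHk. Qed.

Lemma tschur_factorX (t r j : nat) : (0 < t)%N -> (0 < j)%N ->
  tschur_factor t r j = tschur_factor t 1 j ^+ r.
Proof.
move=> t0 j0.
by rewrite /tschur_factor !expr1 -!exprMn -exprVn -exprMn.
Qed.

Lemma tschur_factor_one_mod2 (t j : nat) : (0 < t)%N -> (0 < j)%N ->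
  exists h, tschur_factor t 1 j = 1 + 2%:R * h.
Proof.
move=> t0 j0; have := tschur_den_unit 1%N t0 j0; rewrite /tschur_factor !expr1.
set a := fps_Xn _ (2 * j - 1); set b := fps_Xn _ (t * _) => uD.
exists ((a - b) / ((1 + b) * (1 - a))).
by apply: (mulIr uD); rewrite [RHS]mulrDl -[_ * _ * _ in RHS]mulrA !divrK //; ring.
Qed.

Theorem theorem3p1 (zeta eta m n t : nat)
    (hzeta : (1 <= zeta)%N) (heta : (1 <= eta)%N)
    (ht : (3 <= t)%N) (htodd : odd t) :
  (tschur_overpartitions t (2 ^ zeta * m + eta)%N n
   = tschur_overpartitions t eta n %[mod (2 ^ zeta.+1)%N])%Z.
Proof.
have t0 : (0 < t)%N by apply: leq_trans ht.
(* Factors with j > n are 1 up to degree n, so this finite product suffices for coefficient n,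
   whatever r is. *)
pose U := \prod_(1 <= j < n.+1) tschur_factor t 1 j.
have coefU r : tschur_overpartitions t r n = (U ^+ r) n.
  rewrite (@tschur_overpartitionsE t r n n) // /U -prodrXl.
  congr (coefs _ n); apply: eq_big_nat => j /andP[j0 _].
  exact: tschur_factorX.
have [h UE] : exists h, U = 1 + 2%:R * h.
  apply: prod_one_mod => j; rewrite mem_index_iota => /andP[j0 _].
  exact: tschur_factor_one_mod2.
have [g UzE] := @expr_one_mod_pow2 _ U h zeta UE.
have [k UmE] : exists k, U ^+ (2 ^ zeta * m) = 1 + (2 ^ zeta.+1)%:R * k.
  (* The m-th power becomes a product over ['I_m], so m = 0 needs no separate case. *)
  rewrite exprM -[m]card_ord -prodr_const.
  by apply: prod_one_mod => i _; exists g.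
(* The integer 2^(zeta+1) factors out of the n-th coefficient of 2^(zeta+1) k U^eta. *)
rewrite !coefU exprD UmE mulrDl mul1r -mulrA mulr_natl fpsDE fpsMnE.
by rewrite -mulr_natr natz addrC modzMDl.
Qed.
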